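(* For $j=1,6$ and every $n\ge 1$ the genus distribution of ${\cal S}_j^n$ is log-concave. Moreover, writing $p_j(n)$ for the peak of the genus distribution of ${\cal S}_j^n$, one has $$p_1(n)=\Big[\frac{n+1}{3}\Big]\quad\text{if } n\ge 1 \text{ and } n\ne 2,$$ and $$p_6(n)=\Big[\frac{n+2}{3}\Big]\quad\text{if } n\ge 2.$$
   Context: $[x]$ denotes the largest integer not exceeding $x$. A surface is represented by a cyclic word in which every occurring letter $x$ appears exactly once as $x$ and exactly once as $x^-$; it is the closed orientable surface obtained from a polygon with boundary labelled by the word by identifying each side $x$ with the side $x^-$ (orientation reversed), and its genus is the genus of that surface. Let $a,a_1,a_2,\dots$ be distinct letters. For $n\ge 1$ and subsets $K,T\subseteq\{1,\dots,n\}$ put: $R_1^n$ = product of the letters $a_k$, $k\in K$, in decreasing order of index; $R_2^n$ = product of the $a_k$, $k\notin K$, in increasing order of index; $R_3^n$ = product of the $a_t^-$, $t\in T$, in decreasing order of index; $R_4^n$ = product of the $a_t^-$, $t\notin T$, in increasing order of index. The sets of ladder surfaces considered are ${\cal S}_1^n=\{R_1^nR_2^nR_3^nR_4^n\}$ and ${\cal S}_6^n=\{aR_1^nR_4^na^-R_2^nR_3^n\}$, where $(K,T)$ runs over all $4^n$ pairs of subsets and surfaces are counted with multiplicity (one for each pair). $g_{i_j}(n)$ is the number of surfaces of genus $i$ in ${\cal S}_j^n$, and the genus distribution of ${\cal S}_j^n$ is the sequence $g_{\gamma_j}(n),g_{\gamma_j+1}(n),\dots,g_{\gamma_{M_j}}(n)$,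 where $\gamma_j$ and $\gamma_{M_j}$ are the minimum and maximum genus of surfaces in ${\cal S}_j^n$. A finite sequence of nonnegative numbers is log-concave if $a_i^2\ge a_{i-1}a_{i+1}$ for all interior indices $i$. It is unimodal if $a_q\le\cdots\le a_{l-1}<a_l=\cdots=a_m>a_{m+1}\ge\cdots\ge a_n$ for some $q\le l\le m\le n$; $l,\dots,m$ are its modes, and if $l=m$ then $m$ is called the peak (indices are genera). *)

(* Defs.v *)
From mathcomp Require Import all_boot.

Set Implicit Arguments.
Unset Strict Implicit.
Unset Printing Implicit Defensive.

(* A side of the polygon is a letter together with an orientation:
   (x, true) is the side x and (x, false) is the side x^-.  A word is read
   cyclically, and is meant to contain each occurring letter exactly once as
   x and exactly once as x^-. *)
Section Surface.
Variable L : eqType.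

Definition word := seq (L * bool).

Definition surface_word (w : word) :=
  uniq w && all (fun s : L * bool => (s.1, ~~ s.2) \in w) w.

Variable w : word.

Definition side (i : 'I_(size w)) : L * bool := tnth (in_tuple w) i.

Definition paired (i j : 'I_(size w)) : bool :=
  ((side i).1 == (side j).1) && ((side i).2 != (side j).2).

(* Corners are indexed like sides: side i runs from corner i to corner
   ordS i (cyclic successor).  Gluing the sides i and j with reversed
   orientation identifies corner i with corner ordS j, and corner ordS i with
   corner j; the second identification is the instance of the first one with
   i and j exchanged. *)
Definition corner_glued : rel 'I_(size w) := fun u v =>
  [exists i, exists j, paired i j &&
    ((u == i) && (v == ordS j) || (u == ordS j) && (v == i))].

Lemma corner_glued_sym : symmetric corner_glued.
Proof.
move=> u v; rewrite /corner_glued.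
apply: eq_existsb => i; apply: eq_existsb => j; congr (_ && _).
by rewrite orbC; congr (_ || _); rewrite andbC.
Qed.

Definition nb_vertices : nat := n_comp corner_glued predT.
Definition nb_edges : nat := (size w)./2.

(* V - E + F = 2 - 2g with F = 1, i.e. g = (E + 1 - V) / 2.  For a surface
   word the glued surface is connected, closed and orientable, so that
   E + 1 - V is even and nonnegative: neither truncation ever takes effect. *)
Definition genus : nat := (nb_edges.+1 - nb_vertices)./2.

End Surface.

Section Ladder.
Variable n : nat.

(* The letter Some k, for k : 'I_n, stands for a_(k+1), and None stands for
   the letter a.  A subset of {1, ..., n} is a K : {set 'I_n}; enum lists its
   elements in increasing order. *)
Definition letter := option 'I_n.

Definition pos (s : seq 'I_n) : word letter := [seq (Some k, true) | k <- s].
Definition neg (s : seq 'I_n) : word letter := [seq (Some k, false) | k <- s].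

Definition R1 (K : {set 'I_n}) : word letter := pos (rev (enum K)).
Definition R2 (K : {set 'I_n}) : word letter := pos (enum (~: K)).
Definition R3 (T : {set 'I_n}) : word letter := neg (rev (enum T)).
Definition R4 (T : {set 'I_n}) : word letter := neg (enum (~: T)).

(* Surfaces are counted with multiplicity, so a set of ladder surfaces is the
   family of its words indexed by the pairs (K, T). *)
Definition family := {set 'I_n} * {set 'I_n} -> word letter.

Definition S1 : family := fun KT =>
  R1 KT.1 ++ R2 KT.1 ++ R3 KT.2 ++ R4 KT.2.

Definition S6 : family := fun KT =>
  (None, true) :: R1 KT.1 ++ R4 KT.2 ++
  (None, false) :: R2 KT.1 ++ R3 KT.2.

Definition genus_count (S : family) (i : nat) : nat :=
  #|[set KT | genus (S KT) == i]|.

Definition min_genus (S : family) : nat :=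
  genus (S [arg min_(KT < (set0, set0)) genus (S KT)]).

Definition max_genus (S : family) : nat := \max_KT genus (S KT).

End Ladder.

(* A finite sequence a_q, ..., a_r is given by a function on nat together with
   the bounds q and r of its index range. *)
Definition log_concave (a : nat -> nat) (q r : nat) : Prop :=
  forall i, q < i -> i < r -> a i.-1 * a i.+1 <= a i ^ 2.

(* a_q <= ... <= a_(l-1) < a_l = ... = a_m > a_(m+1) >= ... >= a_r *)
Definition unimodal_modes (a : nat -> nat) (q r l m : nat) : Prop :=
  [/\ q <= l <= m, m <= r,
      (forall i, q <= i -> i.+1 < l -> a i <= a i.+1)
        /\ (q < l -> a l.-1 < a l),
      forall i, l <= i <= m -> a i = a l
    & (m < r -> a m.+1 < a m)
        /\ (forall i, m < i -> i < r -> a i.+1 <= a i)].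

Definition peak (a : nat -> nat) (q r p : nat) : Prop :=
  unimodal_modes a q r p p.

Definition distribution_log_concave n (S : family n) : Prop :=
  log_concave (genus_count S) (min_genus S) (max_genus S).

Definition distribution_peak n (S : family n) (p : nat) : Prop :=
  peak (genus_count S) (min_genus S) (max_genus S) p.

Lemma ladder_perm n (KT : {set 'I_n} * {set 'I_n}) :
  perm_eq (S1 KT) (pos (enum 'I_n) ++ neg (enum 'I_n)).
Proof.
have H (A : {set 'I_n}) : perm_eq (rev (enum A) ++ enum (~: A)) (enum 'I_n).
  apply: uniq_perm; rewrite ?enum_uniq //.
    rewrite cat_uniq rev_uniq !enum_uniq andbT /=.
    by apply/hasPn=> x; rewrite mem_rev !mem_enum inE.
  by move=> x; rewrite mem_cat mem_rev !mem_enum !inE orbN.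
rewrite /S1 catA /R1 /R2 /R3 /R4 /pos /neg -!map_cat.
by apply: perm_cat; apply: perm_map.
Qed.

Lemma ladder_perm6 n (KT : {set 'I_n} * {set 'I_n}) :
  perm_eq (S6 KT)
    ((None, true) :: (None, false) :: pos (enum 'I_n) ++ neg (enum 'I_n)).
Proof.
apply: (@perm_trans _ ((None, true) :: (None, false) :: S1 KT)); last first.
  by rewrite !perm_cons ladder_perm.
apply/permP=> p; rewrite /S6 /S1 /= !count_cat /= !count_cat; congr (_ + _).
by rewrite addnCA (addnC (count p (R4 _))) -!addnA addnCA; congr (_ + _);
   rewrite addnCA; congr (_ + _); rewrite addnA.
Qed.

Lemma perm_surface_word (L : eqType) (w w' : word L) :
  perm_eq w w' -> surface_word w = surface_word w'.
Proof.
move=> ww'; rewrite /surface_word (perm_uniq ww') (perm_all _ ww').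
by congr (_ && _); apply: eq_all => s; apply: perm_mem.
Qed.

Lemma mem_pos n (k : 'I_n) b : ((Some k, b) \in pos (enum 'I_n)) = b.
Proof.
apply/mapP/idP=> [[j _ [_ ->]]//|bT].
by exists k; rewrite ?mem_enum ?bT.
Qed.

Lemma mem_neg n (k : 'I_n) b : ((Some k, b) \in neg (enum 'I_n)) = ~~ b.
Proof.
apply/mapP/idP=> [[j _ [_ ->]]//|bF].
by exists k; rewrite ?mem_enum ?(negbTE bF).
Qed.

Lemma all_sides_surface_word n :
  surface_word (pos (enum 'I_n) ++ neg (enum 'I_n)).
Proof.
apply/andP; split.
  have inj (b : bool) : injective (fun k : 'I_n => (Some k, b)) by move=> x y [].
  rewrite cat_uniq !(map_inj_uniq (inj _)) !enum_uniq andbT /=.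
  by apply/hasPn=> _ /mapP[k _ ->]; rewrite /= mem_pos.
apply/allP=> s; rewrite !mem_cat => /orP[] /mapP[k _ ->] /=.
  by rewrite mem_neg orbT.
by rewrite mem_pos.
Qed.

Lemma S1_surface_word n (KT : {set 'I_n} * {set 'I_n}) : surface_word (S1 KT).
Proof. by rewrite (perm_surface_word (ladder_perm KT)) all_sides_surface_word. Qed.

Lemma S6_surface_word n (KT : {set 'I_n} * {set 'I_n}) : surface_word (S6 KT).
Proof.
rewrite (perm_surface_word (ladder_perm6 KT)).
have /andP[u a] := all_sides_surface_word n.
apply/andP; split => /=.
  rewrite u !inE !mem_cat andbT /=.
  by apply/andP; split; apply/norP; split; apply/mapP=> -[].
by apply/allP=> s sw; rewrite !inE; move/allP: a => /(_ s sw) ->; rewrite !orbT.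
Qed.

(* Main.v *)
Require Import Defs.
From mathcomp Require Import all_boot.
From mathcomp Require Import zify.
From Stdlib Require Import ArithRing.

Set Implicit Arguments.
Unset Strict Implicit.
Unset Printing Implicit Defensive.

(* The number V of vertices of a surface word is read off from its 2^V
   colourings of the vertices by two colours.  Such a colouring makes every
   block of the word a 2 x 2 transfer matrix, and the colourings of a cyclic
   word are counted by a trace; the invariance of this count under rotation,
   cancellation of x x^-, extraction of a handle a .. x .. a^- .. x^-, and
   rotation of one boundary of an annulus a .. a^- .. are matrix identities.

   In S1, the letter a_1 always sits between R1 and R2, and a_1^- between R3
   and R4, so that S1 at n+1 is four copies of the family a R2 R3 a^- R4 R1,
   which has the same genera as S6.  Removing the letter a_(n+1) from the
   latter leaves, in two cases out of four, the same family at n, and in the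
   two others a handle and S1 at n.  So the genus distribution s_n of S6
   satisfies s_(n+2)(i) = 2 s_(n+1)(i) + 8 s_n(i-1), and is
   2^(n+i-1) (C(n+1-i, i) + C(n-i, i)).  Log-concavity and the peak follow
   from the ratio of consecutive terms, which is a rational function. *)

(** * Counting vertices by colourings *)

(** A closed set is a union of components, so it is determined by the component roots it contains,
    and every set of roots occurs. *)
Lemma card_closed_sets (T : finType) (e : rel T) : connect_sym e ->
  #|[set A : {set T} | [forall x, forall y, e x y ==> ((x \in A) == (y \in A))]]|
    = 2 ^ n_comp e predT.
Proof.
move=> sym_e; set CL := [set A : {set T} | _].
have CLP (A : {set T}) : reflect (closed e A) (A \in CL).
  rewrite inE; apply: (iffP forallP) => [H x y exy | H x].
    by have /forallP/(_ y)/implyP/(_ exy)/eqP := H x.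
  by apply/forallP=> y; apply/implyP=> /H ->.
pose R := [set x | roots e x].
have -> : n_comp e predT = #|R|.
  by apply: eq_card => x; rewrite !inE andbT.
rewrite -card_powerset; pose f (A : {set T}) := A :&: R.
have <- : f @: CL = powerset R.
  apply/setP=> B; rewrite inE; apply/imsetP/idP=> [[A _ ->]|sBR].
    exact: subsetIr.
  exists [set x | root e x \in B].
    by apply/CLP=> x y exy; rewrite !inE (rootP sym_e (connect1 exy)).
  apply/setP=> x; rewrite !inE; case: (boolP (roots e x)) => [/eqP->|nR].
    by rewrite andbT.
  by rewrite andbF; apply: contraNF nR => /(subsetP sBR); rewrite inE.
rewrite card_in_imset // => A B /CLP cA /CLP cB eqAB.
have rR x : root e x \in R by rewrite inE roots_root.
apply/setP=> x; move/setP/(_ (root e x)): eqAB; rewrite !in_setI rR !andbT.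
rewrite -(closed_connect cA (connect_root e x)).
by rewrite -(closed_connect cB (connect_root e x)).
Qed.

Section Transfer.
Variable L : eqType.
Implicit Types (s a x : L * bool) (A B w : word L).

Definition opp s : L * bool := (s.1, ~~ s.2).

Lemma oppK : involutive opp.
Proof. by case=> l b; rewrite /opp /= negbK. Qed.

Definition avoids a w := all (fun s : L * bool => s.1 != a.1) w.

Lemma avoids_cat a A B : avoids a (A ++ B) = avoids a A && avoids a B.
Proof. exact: all_cat. Qed.

End Transfer.

Section Colourings.
Variable L : finType.
Implicit Types (s a x : L * bool) (A B w : word L) (c : {set L * bool}).

(* A set [c] of sides encodes the 2-colouring of corners in which the side [s]
   starts at a corner of colour [s \in c], and hence ends at one of colour
   [opp s \in c].  [walks c p q w] is 1 if [w] is then a walk from colour [p] to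
   colour [q], and 0 otherwise. *)
Fixpoint walks c (p q : bool) w : nat :=
  if w is s :: w' then ((s \in c) == p) * walks c (opp s \in c) q w' else p == q.

Definition closed_walks c w := walks c true true w + walks c false false w.

(** Requiring [c \subset w] fixes the sides outside [w], so that each choice of colours on the sides
    of [w] is counted once. *)
Definition colourings w := \sum_(c : {set L * bool} | c \subset w) closed_walks c w.

Lemma walks_cat c p q A B :
  walks c p q (A ++ B)
    = walks c p true A * walks c true q B + walks c p false A * walks c false q B.
Proof.
elim: A p => [|s A IH] p /=; last by rewrite IH mulnDr !mulnA.
by case: p; case: q; rewrite ?mul1n ?mul0n ?addn0.
Qed.

Lemma walks_cat_cons c p q A s B :
  walks c p q (A ++ s :: B) = walks c p (s \in c) A * walks c (opp s \in c) q B.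
Proof.
by rewrite walks_cat /=; case: (s \in c); rewrite !(mul0n, mul1n, muln0) ?addn0.
Qed.

Lemma closed_walks_cons c s w :
  closed_walks c (s :: w) = walks c (opp s \in c) (s \in c) w.
Proof.
by rewrite /closed_walks /=; case: (s \in c); rewrite !(mul0n, mul1n) ?addn0.
Qed.

Lemma closed_walks_catC c A B : closed_walks c (A ++ B) = closed_walks c (B ++ A).
Proof. rewrite /closed_walks !walks_cat; lia. Qed.

Lemma colourings_catC A B : colourings (A ++ B) = colourings (B ++ A).
Proof.
rewrite /colourings; apply: eq_big => c; last by rewrite closed_walks_catC.
by apply: eq_subset_r => s; rewrite !mem_cat orbC.
Qed.

Definition upd c a (p q : bool) : {set L * bool} :=
  [set s | if s == a then p else if s == opp a then q else s \in c].

Lemma opp_neq a : (opp a == a) = false.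
Proof. by case: a => l b; rewrite /opp /eq_op /= eqxx; case: b. Qed.

Lemma upd_same c a p q : (a \in upd c a p q) = p.
Proof. by rewrite inE eqxx. Qed.

Lemma upd_opp c a p q : (opp a \in upd c a p q) = q.
Proof. by rewrite inE eqxx opp_neq. Qed.

Lemma upd_other c a p q s : s.1 != a.1 -> (s \in upd c a p q) = (s \in c).
Proof.
by move=> sa; rewrite inE -!pair_eqE /= (negbTE sa).
Qed.

Lemma walks_upd c a p q u v A : avoids a A -> walks (upd c a p q) u v A = walks c u v A.
Proof.
elim: A u => //= s A IH u /andP[sa /IH->].
by rewrite !upd_other.
Qed.

Lemma mem_avoids a w : avoids a w -> (a \in w) = false /\ (opp a \in w) = false.
Proof.
by move=> /allP H; split; apply/negP=> /H; rewrite eqxx.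
Qed.

(** A set of sides of [w] amounts to a set of sides of [w'] together with the colours of the two
    ends of [a]. *)
Lemma sum_colourings_letter a w w' (F : {set L * bool} -> nat) :
  avoids a w' -> perm_eq w (a :: opp a :: w') ->
  \sum_(c : {set L * bool} | c \subset w) F c =
  \sum_(c : {set L * bool} | c \subset w')
     (F (upd c a true true) + F (upd c a true false)
      + (F (upd c a false true) + F (upd c a false false))).
Proof.
move=> aw' pw; have [aNw oNw] := mem_avoids aw'.
rewrite [RHS](eq_bigr (fun c => \sum_p \sum_q F (upd c a p q))); last first.
  by move=> c _; rewrite !big_bool.
under [RHS]eq_bigr do rewrite pair_big /=.
rewrite pair_big /=.
pose h (j : {set L * bool} * (bool * bool)) := upd j.1 a j.2.1 j.2.2.
pose h' (c : {set L * bool}) := (c :\ a :\ opp a, (a \in c, opp a \in c)).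
rewrite (reindex_onto h h') /=; last first.
  move=> c _; apply/setP=> s; rewrite !inE /=.
  case: (s =P a) => [->//|_]; by case: (s =P opp a) => [->|].
apply: eq_bigl => -[c [p q]] /=; rewrite /h' /h /= upd_same upd_opp.
apply/andP/idP=> [[sub /eqP[ec]]|sub].
  rewrite andbT; apply/subsetP=> s; rewrite -ec !inE => /and3P[s1 s2].
  move=> s3; have/(subsetP sub) : s \in upd c a p q by rewrite inE.
  by rewrite (perm_mem pw) !inE (negbTE s1) (negbTE s2).
rewrite andbT in sub; split.
  apply/subsetP=> s; rewrite (perm_mem pw) !inE.
  case: (s =P a) => //= _; case: (s =P opp a) => //= _; exact: (subsetP sub).
apply/eqP; congr (_, _); apply/setP=> s; rewrite !inE.
case: (s =P opp a) => [->|_] /=.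
  by symmetry; apply: contraFF oNw; apply: (subsetP sub).
case: (s =P a) => [->|_] //=.
by symmetry; apply: contraFF aNw; apply: (subsetP sub).
Qed.

(** The walk goes along [a] and straight back; the colour at the tip is free, hence the factor 2. *)
Lemma colourings_cancel a A B : avoids a (A ++ B) ->
  colourings (A ++ a :: opp a :: B) = 2 * colourings (A ++ B).
Proof.
move=> av; rewrite /colourings (@sum_colourings_letter a _ _ _ av); last first.
  by apply/permP=> p; rewrite /= !count_cat /=; lia.
rewrite big_distrr /=; apply: eq_bigr => c _.
move: av; rewrite avoids_cat => /andP[avA avB].
rewrite /closed_walks !walks_cat /= oppK ?upd_same ?upd_opp !walks_upd //=.
rewrite !(mul0n, mul1n, muln0, muln1, add0n, addn0).
by rewrite -?plusE -?multE; ring.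
Qed.

(* Only the cyclic words A and B matter to an annulus a A a^- B. *)
Lemma colourings_annulus a A1 A2 B : avoids a (A1 ++ A2 ++ B) ->
  colourings (a :: A1 ++ A2 ++ opp a :: B) =
  colourings (a :: A2 ++ A1 ++ opp a :: B).
Proof.
move=> av; rewrite /colourings.
rewrite (@sum_colourings_letter a _ _ _ av); last first.
  by apply/permP=> p; rewrite /= !count_cat /=; lia.
rewrite (@sum_colourings_letter a (a :: A2 ++ _) _ _ av); last first.
  by apply/permP=> p; rewrite /= !count_cat /=; lia.
apply: eq_bigr => c _.
move: av; rewrite !avoids_cat => /and3P[av1 av2 avB].
rewrite !closed_walks_cons !catA !walks_cat_cons !oppK !upd_same !upd_opp !walks_upd //;
  try by rewrite avoids_cat av1 av2.
(* With the ends of [a] coloured, [A1 ++ A2] and [B] are separate closed walks; the four terms add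
   up to a product of two traces, and a trace is invariant under rotation. *)
rewrite !walks_cat.
by rewrite -?plusE -?multE; ring.
Qed.

(** Once the ends of [a] and [x] are coloured, the blocks chain up as matrix entries in the order S,
    R, Q, T, and summing over the colours gives the trace of that product. *)
Lemma colourings_handle a x Q R S T : a.1 != x.1 ->
  avoids a (S ++ R ++ Q ++ T) -> avoids x (S ++ R ++ Q ++ T) ->
  colourings (a :: Q ++ x :: R ++ opp a :: S ++ opp x :: T) =
  colourings (S ++ R ++ Q ++ T).
Proof.
move=> ax ava avx; rewrite /colourings.
have avax : avoids a (x :: opp x :: S ++ R ++ Q ++ T).
  by rewrite /= eq_sym ax.
rewrite (sum_colourings_letter _ avax); last first.
  rewrite perm_cons; apply/permP=> p.
  by rewrite /= !count_cat /= !count_cat /= !count_cat /=; lia.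
rewrite (@sum_colourings_letter x _ _ _ avx (perm_refl _)).
apply: eq_bigr => c _.
move: ava avx; rewrite !avoids_cat.
move=> /and4P[a1 a2 a3 a4] /and4P[x1 x2 x3 x4].
have xa : x.1 != a.1 by rewrite eq_sym.
have E p q u v : closed_walks (upd (upd c x u v) a p q)
    (a :: Q ++ x :: R ++ opp a :: S ++ opp x :: T)
    = walks c q u Q * (walks c v q R * (walks c p v S * walks c u p T)).
  by rewrite closed_walks_cons !walks_cat_cons !oppK !upd_same !upd_opp !walks_upd
             ?(@upd_other _ a) ?upd_same ?upd_opp.
rewrite !E /closed_walks !walks_cat.
by rewrite -?plusE -?multE; ring.
Qed.

End Colourings.

(** * The genus from the number of colourings *)

Section Genus.
Variable L : finType.
Implicit Types (a x : L * bool) (w A B : word L) (c : {set L * bool}).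

Lemma walks_path c q s w :
  walks c (opp s \in c) q w
    = (path (fun t u => (opp t \in c) == (u \in c)) s w
       && ((opp (last s w) \in c) == q)) :> nat.
Proof.
elim: w s => //= t w IH s; rewrite IH [in LHS]eq_sym.
by case: (_ == _); rewrite ?mul1n ?mul0n.
Qed.

Lemma closed_walks_cycle c w : w != [::] ->
  closed_walks c w = cycle (fun t u => (opp t \in c) == (u \in c)) w :> nat.
Proof. by case: w => // s w _; rewrite closed_walks_cons walks_path /= rcons_path. Qed.

Lemma colourings_cycle w : w != [::] ->
  colourings w = #|[set c : {set L * bool} | (c \subset w)
     && cycle (fun t u => (opp t \in c) == (u \in c)) w]|.
Proof.
move=> w0; rewrite -sum1_card /colourings big_mkcond [RHS]big_mkcond /=.
apply: eq_bigr => c _; rewrite inE; case: (c \subset w) => //=.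
by rewrite closed_walks_cycle //; case: cycle.
Qed.

Lemma side_ordS w (i : 'I_(size w)) : uniq w -> side (ordS i) = next w (side i).
Proof.
case: w i => [[]//|s w] i uw.
rewrite next_nth /side !(tnth_nth s) mem_nth // index_uniq //=.
have := ltn_ord i; rewrite [X in _ < X]/= ltnS leq_eqVlt => /orP[/eqP->|lt_i].
  by rewrite modnn /= nth_default.
by rewrite modn_small.
Qed.

(** A corner takes the colour of the side starting there. Since the opposite of a side carries the
    colour of its end, a set of sides closes up along [w] exactly when the corresponding set of
    corners is closed under gluing. The empty word has two colourings but no corner. *)
Lemma colourings_vertices w : surface_word w -> w != [::] ->
  colourings w = 2 ^ nb_vertices w.
Proof.
move=> /andP[uw /allP cw] w0; rewrite colourings_cycle //.
have sym_g : connect_sym (@corner_glued _ w).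
  by apply: sym_connect_sym; apply: corner_glued_sym.
rewrite /nb_vertices -card_closed_sets //.
have side_inj : injective (@side _ w).
  exact/(tuple_uniqP (in_tuple w)).
have sideP s : s \in w -> exists i, s = @side _ w i.
  by move=> sw; apply/(tnthP (in_tuple w)).
have side_in i : @side _ w i \in w by apply: mem_tnth.
have pairE i j : paired i j = (@side _ w j == opp (@side _ w i)).
  rewrite /paired /opp -pair_eqE /= eq_sym; congr (_ && _).
  by case: (side i).2; case: (side j).2.
have mside (C : {set 'I_(size w)}) i : (side i \in @side _ w @: C) = (i \in C).
  exact: mem_imset.
rewrite -[RHS](card_imset _ (imset_inj side_inj)); apply: eq_card => c.
rewrite inE; apply/andP/imsetP => [[/subsetP sub cyc]|[C]].
  exists [set i | side i \in c]; last first.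
    apply/setP=> s; apply/idP/imsetP=> [sc|[i]]; last by rewrite inE => ? ->.
    by have [i Ei] := sideP _ (sub _ sc); exists i; rewrite ?inE -?Ei.
  rewrite inE; apply/forallP=> u; apply/forallP=> v; apply/implyP.
  case/existsP=> i /existsP[j /andP[]]; rewrite pairE => /eqP pij.
  suff E : (side i \in c) = (side (ordS j) \in c).
    by case/orP=> /andP[/eqP-> /eqP->]; rewrite !inE E.
  have /eqP := next_cycle cyc (side_in j).
  by rewrite -side_ordS // pij oppK.
rewrite inE => /forallP H ->; split.
  by apply/subsetP=> _ /imsetP[i _ ->].
apply: (cycle_from_next uw) => s /sideP[j ->].
have /sideP[i Ei] : opp (side j) \in w by apply: cw.
rewrite -side_ordS // Ei !mside.
have /forallP/(_ (ordS j))/implyP := H i; apply.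
apply/existsP; exists i; apply/existsP; exists j.
by rewrite pairE -Ei oppK !eqxx.
Qed.

(* [2 ^ V * 4 ^ g = 2 ^ (E + 1)], that is Euler's formula with one face. *)
Definition euler w g := colourings w * 4 ^ g = 2 ^ (size w)./2.+1.

Lemma colourings_nil : colourings ([::] : word L) = 2.
Proof.
rewrite /colourings (eq_bigl (pred1 set0)) => [|c].
  by rewrite big_pred1_eq.
by rewrite [in RHS]/= -subset0; apply: eq_subset_r => s; rewrite !inE.
Qed.

Lemma euler_nil : euler ([::] : word L) 0.
Proof. by rewrite /euler colourings_nil. Qed.

Lemma euler_catC A B g : euler (A ++ B) g -> euler (B ++ A) g.
Proof. by rewrite /euler colourings_catC !size_cat addnC. Qed.

Lemma euler_cancel a A B g : avoids a (A ++ B) ->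
  euler (A ++ B) g -> euler (A ++ a :: opp a :: B) g.
Proof.
move=> av E; rewrite /euler colourings_cancel // -mulnA E -expnS.
by rewrite !size_cat /= !addnS.
Qed.

Lemma euler_annulus a A1 A2 B g : avoids a (A1 ++ A2 ++ B) ->
  euler (a :: A1 ++ A2 ++ opp a :: B) g ->
  euler (a :: A2 ++ A1 ++ opp a :: B) g.
Proof.
move=> av; rewrite /euler colourings_annulus //= !size_cat.
by rewrite [size A1 + _]addnCA.
Qed.

Lemma euler_handle a x Q R S T g : a.1 != x.1 ->
  avoids a (S ++ R ++ Q ++ T) -> avoids x (S ++ R ++ Q ++ T) ->
  euler (S ++ R ++ Q ++ T) g ->
  euler (a :: Q ++ x :: R ++ opp a :: S ++ opp x :: T) g.+1.
Proof.
move=> ax ava avx E; rewrite /euler colourings_handle // expnSr mulnA E.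
rewrite -[4]/(2 ^ 2) -expnD addn2; congr (2 ^ _.+1).
by rewrite /= !size_cat /= !size_cat /= !size_cat /=; lia.
Qed.

Lemma genus_euler w g : surface_word w -> euler w g -> genus w = g.
Proof.
rewrite /euler /genus /nb_edges -[4]/(2 ^ 2) -expnM; case: (eqVneq w [::]) => [->|w0 sw].
  rewrite colourings_nil => _ /eqP; rewrite -[X in _ == X]muln1 eqn_mul2l /=.
  rewrite -[X in _ == X](expn0 2) eqn_exp2l // muln_eq0 /= => /eqP->.
  (* The value of V does not matter here: 1 - V halves to 0 in any case. *)
  by case: nb_vertices => [|[]].
rewrite colourings_vertices // -expnD => /eqP; rewrite eqn_exp2l // => /eqP <-.
by rewrite addKn mul2n doubleK.
Qed.

End Genus.

Section Relabelling.
Variables (L L' : finType) (f : L * bool -> L' * bool).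
Hypotheses (f_inj : injective f) (f_opp : forall s, f (opp s) = opp (f s)).

(** [f] acts on sides rather than letters, so that it may also reverse a letter, as for [None] in
    [annular_S6]. *)
Lemma colourings_map w : colourings (map f w) = colourings w.
Proof.
have walksE (c : {set L * bool}) p q : walks (f @: c) p q (map f w) = walks c p q w.
  by elim: w p => //= s w' IH p; rewrite -f_opp !(mem_imset _ _ f_inj) IH.
rewrite /colourings
  (reindex_onto (fun c : {set L * bool} => f @: c)
     (fun c : {set L' * bool} => f @^-1: c)) /=.
  apply: eq_big => c; last by rewrite /closed_walks !walksE.
  have -> : f @^-1: (f @: c) = c by apply/setP=> s; rewrite inE mem_imset.
  rewrite eqxx andbT; apply/subsetP/subsetP=> sub s.
    by move=> sc; rewrite -(mem_map f_inj) sub ?imset_f.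
  by case/imsetP=> t /sub tw ->; rewrite map_f.
move=> c /subsetP sub; apply/setP=> s; apply/imsetP/idP=> [[t]|sc].
  by rewrite inE => tc ->.
have /mapP[t _ Es] := sub _ sc.
by exists t; rewrite ?inE -?Es.
Qed.

Lemma euler_map w g : euler (map f w) g <-> euler w g.
Proof. by rewrite /euler colourings_map size_map. Qed.

End Relabelling.

(** * The ladder families *)

Section Families.
Variable n : nat.
Implicit Types (K T : {set 'I_n}) (KT : {set 'I_n} * {set 'I_n}).

(* Both a relabelling of S6, once the two halves of the first boundary of its
   annulus have been exchanged, and what is left of S1 at n+1 when the letter
   a_1 is renamed a. *)
Definition annular : Defs.family n := fun KT =>
  (None, true) :: R2 KT.1 ++ R3 KT.2 ++
  (None, false) :: R4 KT.2 ++ R1 KT.1.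

Lemma annular_surface_word KT : surface_word (annular KT).
Proof.
rewrite (@perm_surface_word _ _ (S6 KT)) ?S6_surface_word //.
by apply/permP=> p; rewrite /annular /S6 /= !count_cat /= !count_cat; lia.
Qed.

End Families.

Definition relabel (L L' : eqType) (h : L -> L') (s : L * bool) := (h s.1, s.2).

Lemma euler_relabel (L L' : finType) (h : L -> L') (w : word L) g :
  injective h -> euler (map (relabel h) w) g <-> euler w g.
Proof.
move=> h_inj; apply: euler_map; last by case.
by move=> [l b] [l' b'] [/h_inj -> ->].
Qed.

Lemma avoids_relabel (L L' : eqType) (h : L -> L') a (w : word L) :
  (forall l, h l != a.1) -> avoids a (map (relabel h) w).
Proof. by move=> ha; apply/allP=> _ /mapP[s _ ->]; apply: ha. Qed.

Lemma avoids_None n (b b' : bool) (s : seq 'I_n) :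
  avoids (None, b) [seq (Some k, b') | k <- s].
Proof. by apply/allP=> _ /mapP[s' _ ->]. Qed.

(** Exchange [R1] and [R4] inside the annulus, rotate the word to begin with a^-, and swap a with
    a^-. *)
Lemma annular_S6 n (KT : {set 'I_n} * {set 'I_n}) g :
  euler (annular KT) g -> euler (S6 KT) g.
Proof.
move=> eA; apply: euler_annulus; first by rewrite !avoids_cat !avoids_None.
rewrite catA -cat_cons; apply: euler_catC.
pose f (s : letter n * bool) := (s.1, if s.1 is None then ~~ s.2 else s.2).
have fK : involutive f by case=> [[k|] b]; rewrite /f /= ?negbK.
have f_id (b : bool) (t : seq 'I_n) :
    map f [seq (Some k, b) | k <- t] = [seq (Some k, b) | k <- t].
  by rewrite -map_comp; apply: eq_map.
apply/(@euler_map _ _ f (inv_inj fK)); first by case=> [[k|] b].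
by move: eA; rewrite /annular /= !map_cat /= !map_cat !f_id -catA.
Qed.

Section Insert.
Variables (n : nat) (i : 'I_n.+1).

Definition insert (b : bool) (A : {set 'I_n}) : {set 'I_n.+1} :=
  [set k | if unlift i k is Some j then j \in A else b].

Lemma insertC b A : ~: insert b A = insert (~~ b) (~: A).
Proof.
by apply/setP=> k; rewrite !inE; case: unlift => // j; rewrite inE.
Qed.

Lemma mem_insert_self b A : (i \in insert b A) = b.
Proof. by rewrite inE unlift_none. Qed.

Lemma mem_insert_lift b A j : (lift i j \in insert b A) = (j \in A).
Proof. by rewrite inE liftK. Qed.

Lemma insertK (A : {set 'I_n.+1}) : insert (i \in A) (lift i @^-1: A) = A.
Proof.
by apply/setP=> k; rewrite inE; case: unliftP => [j|] -> //; rewrite inE.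
Qed.

Lemma sum_insert (F : {set 'I_n.+1} -> nat) :
  \sum_A F A = \sum_(A : {set 'I_n}) (F (insert true A) + F (insert false A)).
Proof.
rewrite [RHS](eq_bigr (fun A => \sum_b F (insert b A))) => [|A _]; last first.
  by rewrite big_bool.
rewrite pair_big /=.
rewrite (reindex_onto (fun p => insert p.2 p.1)
  (fun A : {set 'I_n.+1} => (lift i @^-1: A, i \in A))) /=.
  apply: eq_bigl => -[A b] /=; rewrite mem_insert_self.
  apply/eqP; congr (_, _); apply/setP=> j.
  by rewrite inE mem_insert_lift.
by move=> A _; apply: insertK.
Qed.
End Insert.

Lemma enum_set_ord n (A : {set 'I_n}) : enum A = [seq k <- enum 'I_n | k \in A].
Proof. by rewrite [in RHS]enumT. Qed.

Lemma filter_insert_lift n (i : 'I_n.+1) b (A : {set 'I_n}) :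
  [seq k <- map (lift i) (enum 'I_n) | k \in insert i b A] = map (lift i) (enum A).
Proof.
rewrite filter_map [enum A]enum_set_ord; congr map; apply: eq_filter => j.
by rewrite /= mem_insert_lift.
Qed.

Lemma enum_insert0 n b (A : {set 'I_n}) :
  enum (insert ord0 b A) = nseq b ord0 ++ map (lift ord0) (enum A).
Proof.
rewrite enum_set_ord enum_ordSl /= mem_insert_self filter_insert_lift.
by case: b.
Qed.

Lemma enum_insert_max n b (A : {set 'I_n}) :
  enum (insert ord_max b A) = map (lift ord_max) (enum A) ++ nseq b ord_max.
Proof.
rewrite enum_set_ord enum_ordSr filter_rcons mem_insert_self.
rewrite (eq_map (g := lift ord_max)) => [|j]; last first.
  by apply/val_inj/esym/lift_max.
by rewrite filter_insert_lift; case: b; rewrite -?cats1 ?cats0.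
Qed.

(** Both lists are strictly decreasing and have the same elements. *)
Lemma enum_rev_ord n (A : {set 'I_n}) :
  map (@rev_ord n) (enum A) = rev (enum (@rev_ord n @: A)).
Proof.
have srt (B : {set 'I_n}) : sorted (fun i j : 'I_n => i < j) (enum B).
  rewrite enum_set_ord; apply: sorted_filter; first by move=> ? ? ?; apply: ltn_trans.
  by rewrite -[sorted _ _]/(sorted (relpre val ltn) _) -sorted_map
             val_enum_ord iota_ltn_sorted.
apply: (@irr_sorted_eq _ (fun i j : 'I_n => j < i)).
- by move=> j i k /= ji kj; apply: ltn_trans kj ji.
- by move=> i; rewrite /= ltnn.
- rewrite sorted_map; apply: sub_sorted (srt A) => i j /= ij; have := ltn_ord j; lia.
- by rewrite rev_sorted.
- move=> i; rewrite mem_rev mem_enum; apply/mapP/imsetP=> -[j]; rewrite ?mem_enum => jA ->;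
  by exists j; rewrite ?mem_enum //.
Qed.

Definition letter0 n (l : letter n) : letter n.+1 :=
  if l is Some k then Some (lift ord0 k) else Some ord0.

Lemma letter0_inj n : injective (@letter0 n).
Proof.
by move=> [k|] [k'|] //= [] //= e; congr Some; apply: val_inj; case: e.
Qed.

(** The smallest index ends a decreasing product and begins an increasing one, so the place of a_1
    and of a_1^- does not depend on [b] and [c]. With a_1 renamed a, moving [R1] to the end gives
    [annular]. *)
Lemma euler_S1_insert n b c (K T : {set 'I_n}) g :
  euler (S1 (insert ord0 b K, insert ord0 c T)) g <-> euler (annular (K, T)) g.
Proof.
suff E : S1 (insert ord0 b K, insert ord0 c T) =
   map (relabel (@letter0 n)) (R1 K ++ (None, true) :: R2 K ++ R3 T ++ (None, false) :: R4 T).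
  rewrite E euler_relabel; last exact: letter0_inj.
  set B := (None, true) :: _; have -> : annular (K, T) = B ++ R1 K.
    by rewrite /annular /B /= -!catA /= -?catA.
  by split; apply: euler_catC.
have E v (t : seq 'I_n) : [seq (Some k, v) | k <- map (lift ord0) t]
    = map (relabel (@letter0 n)) [seq (Some k, v) | k <- t].
  by rewrite -!map_comp.
rewrite /S1 /R1 /R2 /R3 /R4 !insertC !enum_insert0 /pos /neg.
rewrite !map_cat /= !map_cat /= !rev_cat -!map_rev !map_cat !E.
by case: b; case: c; rewrite /= -?catA /=.
Qed.

(** Reversing the indices turns increasing products into decreasing ones; with the complement this
    exchanges the roles of [R1] and [R2], and of [R3] and [R4]. *)
Definition rev_compl n (A : {set 'I_n}) : {set 'I_n} := @rev_ord n @: ~: A.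

Lemma rev_complC n (A : {set 'I_n}) : ~: rev_compl A = @rev_ord n @: A.
Proof.
apply/setP=> j; rewrite inE -(rev_ordK j) !(mem_imset _ _ (@rev_ord_inj n)) inE.
by rewrite negbK.
Qed.

Lemma rev_complK n : involutive (@rev_compl n).
Proof.
move=> A; rewrite {1}/rev_compl rev_complC -imset_comp; apply/setP=> j.
by rewrite (eq_imset (g := id)) ?imset_id // => k; rewrite /= rev_ordK.
Qed.

(** Removing a handle leaves the blocks in the order R4 R3 R2 R1; under [rev_ord] they become R3 R4
    R1 R2 of the new pair, a rotation of [S1]. *)
Lemma euler_S1_rev_compl n (K T : {set 'I_n}) g :
  euler (S1 (rev_compl K, rev_compl T)) g -> euler (R4 T ++ R3 T ++ R2 K ++ R1 K) g.
Proof.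
move=> eS; apply/(euler_relabel _ _ (inj_omap (@rev_ord_inj n))).
have E v (t : seq 'I_n) :
    map (relabel (omap (@rev_ord n))) [seq (Some k, v) | k <- t]
    = [seq (Some k, v) | k <- map (@rev_ord n) t].
  by rewrite -!map_comp.
rewrite !map_cat !E !(map_rev (@rev_ord n)) !enum_rev_ord !revK catA.
apply: euler_catC; move: eS.
by rewrite /S1 /R1 /R2 /R3 /R4 !rev_complC !catA.
Qed.

(** * Removing the letter of largest index *)

Section Outermost.
Variable n : nat.
Implicit Types K T : {set 'I_n}.

Let r := relabel (omap (lift (@ord_max n))).
Let x b : letter n.+1 * bool := (Some ord_max, b).

Lemma map_lift_max v (t : seq 'I_n) :
  [seq (Some k, v) | k <- map (lift (@ord_max n)) t]
    = map r [seq (Some k, v) | k <- t].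
Proof. by rewrite -!map_comp. Qed.

Lemma R1_insert_max b K :
  R1 (insert ord_max b K) = nseq b (x true) ++ map r (R1 K).
Proof.
by rewrite /R1 enum_insert_max rev_cat -map_rev /pos map_cat map_lift_max; case: b.
Qed.

Lemma R2_insert_max b K :
  R2 (insert ord_max b K) = map r (R2 K) ++ nseq (~~ b) (x true).
Proof.
by rewrite /R2 insertC enum_insert_max /pos map_cat map_lift_max; case: b.
Qed.

Lemma R3_insert_max b T :
  R3 (insert ord_max b T) = nseq b (x false) ++ map r (R3 T).
Proof.
by rewrite /R3 enum_insert_max rev_cat -map_rev /neg map_cat map_lift_max; case: b.
Qed.

Lemma R4_insert_max b T :
  R4 (insert ord_max b T) = map r (R4 T) ++ nseq (~~ b) (x false).
Proof.
by rewrite /R4 insertC enum_insert_max /neg map_cat map_lift_max; case: b.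
Qed.

Lemma avoids_max b (w : word (letter n)) : avoids (x b) (map r w).
Proof.
apply: avoids_relabel => -[k|] //; apply/eqP=> /Some_inj /esym/eqP.
by rewrite (negbTE (neq_lift _ _)).
Qed.

Lemma avoids_relabel_None b v (t : seq 'I_n) :
  avoids (None, b) (map r [seq (Some k, v) | k <- t]).
Proof. by rewrite -map_lift_max avoids_None. Qed.

Lemma relabel_max_inj : injective (omap (lift (@ord_max n))).
Proof. exact/inj_omap/lift_inj. Qed.

(** The largest index opens a decreasing product and closes an increasing one. Lying in just one of
    the two sets, it produces x^- x where [R4] meets [R1], or x x^- where [R2] meets [R3]. *)
Lemma euler_annular_cancel b K T g : euler (annular (K, T)) g ->
  euler (annular (insert ord_max b K, insert ord_max (~~ b) T)) g.
Proof.
move/(euler_relabel _ _ relabel_max_inj); rewrite -/r /annular /= !map_cat /= !map_cat /= => eA.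
rewrite R1_insert_max R2_insert_max R3_insert_max R4_insert_max.
case: b => /=; rewrite !cats0 -?catA /=.
  set A1 := map r (R2 K) in eA *; set A2 := map r (R3 T) in eA *.
  set A3 := map r (R4 T) in eA *.
  have := @euler_cancel _ (x false)
    (r (None, true) :: A1 ++ A2 ++ r (None, false) :: A3) (map r (R1 K)) g.
  rewrite /= -?catA /= -?catA => H; apply: H => //.
  by rewrite !avoids_cat /= !avoids_cat !avoids_max.
have := @euler_cancel _ (x true) (r (None, true) :: map r (R2 K))
  (map r (R3 T) ++ r (None, false) :: map r (R4 T) ++ map r (R1 K)) g.
rewrite /= -?catA /= -?catA => H; apply: H => //.
by rewrite !avoids_cat /= !avoids_cat !avoids_max.
Qed.

(** Now one of x, x^- lies between [R2] and [R3] and the other between [R4] and [R1], so they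
    interlace with a and a^-. *)
Lemma euler_annular_handle b K T g : euler (S1 (rev_compl K, rev_compl T)) g ->
  euler (annular (insert ord_max b K, insert ord_max b T)) g.+1.
Proof.
move/euler_S1_rev_compl/(euler_relabel _ _ relabel_max_inj); rewrite -/r !map_cat => eS.
rewrite /annular R1_insert_max R2_insert_max R3_insert_max R4_insert_max.
case: b => /=; rewrite ?cats0 -?catA /=.
  apply: (@euler_handle _ (None, true) (x false)) => //.
    by rewrite !avoids_cat !avoids_relabel_None.
  by rewrite !avoids_cat !avoids_max.
apply: (@euler_handle _ (None, true) (x true)) => //.
  by rewrite !avoids_cat !avoids_relabel_None.
by rewrite !avoids_cat !avoids_max.
Qed.

End Outermost.

(** * Genera in the families and recurrences for the counts *)

Lemma enum_set_ord0 (A : {set 'I_0}) : enum A = [::].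
Proof. by apply: size0nil; rewrite -cardE; apply: eq_card0 => -[]. Qed.

Lemma euler_annular_0 KT : euler (@annular 0 KT) 0.
Proof.
rewrite /annular /R1 /R2 /R3 /R4 !enum_set_ord0.
exact: (@euler_cancel _ (None, true) [::] [::] 0 isT (euler_nil _)).
Qed.

Lemma euler_S1_0 KT : euler (@S1 0 KT) 0.
Proof. by rewrite /S1 /R1 /R2 /R3 /R4 !enum_set_ord0; apply: euler_nil. Qed.

(** Euler's relation is obtained from the reductions, for both families in one simultaneous
    induction, since words of either family at [n.+1] reduce to words of these two at [n]. *)
Lemma annular_S1_euler n :
  (forall KT, exists g, euler (@annular n KT) g) /\ (forall KT, exists g, euler (@S1 n KT) g).
Proof.
elim: n => [|n [IHA IHS]].
  by split=> KT; exists 0; [apply: euler_annular_0 | apply: euler_S1_0].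
split=> -[K T].
  rewrite -(insertK ord_max K) -(insertK ord_max T).
  set K' := _ @^-1: K; set T' := _ @^-1: T.
  move: (_ \in K) (_ \in T) => b c; case: (eqVneq c b) => [->|cb].
    by have [g /euler_annular_handle E] := IHS (rev_compl K', rev_compl T');
      exists g.+1; apply: E.
  have -> : c = ~~ b by case: b c cb => [] [].
  by have [g /euler_annular_cancel E] := IHA (K', T'); exists g; apply: E.
rewrite -(insertK ord0 K) -(insertK ord0 T).
set K' := _ @^-1: K; set T' := _ @^-1: T.
have [g E] := IHA (K', T'); exists g.
exact/euler_S1_insert.
Qed.

Lemma annular_euler n KT : euler (@annular n KT) (genus (annular KT)).
Proof.
have [g E] := (annular_S1_euler n).1 KT.
by rewrite (genus_euler (annular_surface_word KT) E).
Qed.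

Lemma S1_euler n KT : euler (@S1 n KT) (genus (S1 KT)).
Proof.
have [g E] := (annular_S1_euler n).2 KT.
by rewrite (genus_euler (S1_surface_word KT) E).
Qed.

Lemma genus_S6 n KT : genus (@S6 n KT) = genus (annular KT).
Proof.
apply: genus_euler (S6_surface_word _) _; exact/annular_S6/annular_euler.
Qed.

Lemma genus_S1_insert n b c (K T : {set 'I_n}) :
  genus (S1 (insert ord0 b K, insert ord0 c T)) = genus (annular (K, T)).
Proof.
apply: genus_euler (S1_surface_word _) _; exact/euler_S1_insert/annular_euler.
Qed.

Lemma genus_annular_insert n b c (K T : {set 'I_n}) :
  genus (annular (insert ord_max b K, insert ord_max c T))
    = if b == c then (genus (S1 (rev_compl K, rev_compl T))).+1
      else genus (annular (K, T)).
Proof.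
apply: genus_euler (annular_surface_word _) _.
case: eqP => [<-|bc]; first exact/euler_annular_handle/S1_euler.
have -> : c = ~~ b by case: b c bc => [] [].
exact/euler_annular_cancel/annular_euler.
Qed.

Lemma genus_countE n (S : Defs.family n) i :
  genus_count S i = \sum_K \sum_T (genus (S (K, T)) == i).
Proof.
rewrite pair_big /= /genus_count -sum1_card big_mkcond /=.
by apply: eq_bigr => -[K T] _; rewrite inE; case: eqP.
Qed.

Lemma count_S6 n i : genus_count (@S6 n) i = genus_count (@annular n) i.
Proof. by apply: eq_card => KT; rewrite !inE genus_S6. Qed.

Lemma count_S1S n i : genus_count (@S1 n.+1) i = 4 * genus_count (@annular n) i.
Proof.
rewrite !genus_countE (sum_insert ord0) big_distrr /=; apply: eq_bigr => K _.
rewrite !(sum_insert ord0) -big_split big_distrr /=; apply: eq_bigr => T _.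
by rewrite !genus_S1_insert; move: (nat_of_bool _) => z; lia.
Qed.

Lemma sum_rev_compl n (F : {set 'I_n} -> {set 'I_n} -> nat) :
  \sum_K \sum_T F (rev_compl K) (rev_compl T) = \sum_K \sum_T F K T.
Proof.
rewrite [RHS](reindex_inj (inv_inj (@rev_complK n))); apply: eq_bigr => K _.
by rewrite [RHS](reindex_inj (inv_inj (@rev_complK n))).
Qed.

Lemma count_annularS n i : genus_count (@annular n.+1) i =
  2 * genus_count (@annular n) i + 2 * (if i is j.+1 then genus_count (@S1 n) j else 0).
Proof.
(* As [rev_compl] is an involution, the sum may run over reversed complements, which matches the
   handle case term by term. *)
have -> : (if i is j.+1 then genus_count (@S1 n) j else 0)
    = \sum_K \sum_T ((genus (S1 (@rev_compl n K, @rev_compl n T))).+1 == i).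
  rewrite (sum_rev_compl (fun K T => (genus (S1 (K, T))).+1 == i : nat)).
  case: i => [|j]; last by rewrite genus_countE.
  by rewrite big1 // => K _; rewrite big1.
rewrite !genus_countE (sum_insert ord_max) !big_distrr -big_split /=.
apply: eq_bigr => K _.
rewrite !(sum_insert ord_max) !big_distrr -!big_split /=; apply: eq_bigr => T _.
by rewrite !genus_annular_insert /=; do 2!move: (nat_of_bool _) => ?; lia.
Qed.

Lemma genus_count_unique (S : Defs.family 0) i :
  (forall KT, genus (S KT) = 0) -> genus_count S i = (i == 0).
Proof.
move=> gS; have e0 (A : {set 'I_0}) : A = set0 by apply/setP=> -[].
rewrite genus_countE !(big_pred1 set0) => [|A|A]; last 2 first.
- by rewrite (e0 A) /= eqxx.
- by rewrite (e0 A) /= eqxx.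
by rewrite gS eq_sym.
Qed.

Lemma count_annular_0 i : genus_count (@annular 0) i = (i == 0).
Proof.
apply: genus_count_unique => KT.
exact: genus_euler (annular_surface_word _) (euler_annular_0 _).
Qed.

Lemma count_S1_0 i : genus_count (@S1 0) i = (i == 0).
Proof.
apply: genus_count_unique => KT.
exact: genus_euler (S1_surface_word _) (euler_S1_0 _).
Qed.

(** * Binomial form and shape of the distribution *)

(** The counts without their powers of 2; they satisfy [bins n.+2 i.+1 = bins n.+1 i.+1 + bins n
    i]. *)
Definition bins n i := 'C(n.+1 - i, i) + 'C(n - i, i).

(** Doubling avoids the exponent n + i - 1, which is truncated at n = i = 0. The recurrence reaches
    two steps back, through [count_S1S], and comes down to Pascal's rule. *)
Lemma count_annular n i : 2 * genus_count (@annular n) i = 2 ^ (n + i) * bins n i.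
Proof.
rewrite /bins; elim/ltn_ind: n i => -[|[|n]] IH i.
- rewrite count_annular_0; case: i => [|[|i]] //=.
  by rewrite !bin_small ?muln0 //; lia.
- rewrite count_annularS count_annular_0; case: i => [|[|[|i]]]; rewrite ?count_S1_0 //=.
  by rewrite !bin_small ?muln0 //; lia.
rewrite count_annularS mulnDr IH //.
case: i => [|j]; first by rewrite !muln0 !bin0 addn0 !addn0 !expnS; lia.
rewrite count_S1S (mulnCA 2 4) IH // !addSn !addnS !expnS.
(* For [n < j] every binomial involved vanishes. *)
case: (leqP j n) => jn; last first.
  by rewrite !bin_small ?muln0 //; lia.
have -> : n.+3 - j.+1 = (n.+1 - j).+1 by lia.
have -> : n.+2 - j.+1 = (n - j).+1 by lia.
have -> : n.+1 - j = (n - j).+1 by lia.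
rewrite !binS subSS.
by rewrite -?plusE -?multE; ring.
Qed.

(* Writing n = 2 i + d keeps truncated subtraction out of the ratio, except
   in i + 2 d - 1, where it would matter only for i = d = 0. *)
Lemma bins_ratio i d : 0 < i + d ->
  (i.+1 * (i + d) * (i + d.*2 + 2)) * bins (i.*2 + d) i.+1
    = (d * d.+1 * (i + d.*2 - 1)) * bins (i.*2 + d) i.
Proof.
move=> id; rewrite /bins; set M := i + d.
have -> : (i.*2 + d).+1 - i.+1 = M by lia.
have -> : i.*2 + d - i.+1 = M.-1 by lia.
have -> : (i.*2 + d).+1 - i = M.+1 by lia.
have -> : i.*2 + d - i = M by lia.
have E1 : d.+1 * 'C(M.+1, i) = M.+1 * 'C(M, i).
  have := mul_bin_down M.+1 i; rewrite /M.
  by have -> : (i + d).+1 - i = d.+1 by lia.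
have E2 : i.+1 * 'C(M, i.+1) = d * 'C(M, i).
  rewrite mul_bin_left /M; congr (_ * _); lia.
have E3 : M * 'C(M.-1, i.+1) = d.-1 * 'C(M, i.+1).
  by rewrite mul_bin_down /M; congr (_ * _); lia.
(* The absorption identities [E1], [E2], [E3] make both sums of binomials multiples of ['C(M, i)]:
   [L] treats the one at [i.+1], [U] the one at [i]. *)
have L : i.+1 * M * ('C(M, i.+1) + 'C(M.-1, i.+1)) = (M + d.-1) * (d * 'C(M, i)).
  by rewrite -mulnA mulnDr E3 -mulnDl mulnCA E2.
have U : d.+1 * ('C(M.+1, i) + 'C(M, i)) = (i + d.*2 + 2) * 'C(M, i).
  by rewrite mulnDr E1 -mulnDl /M; congr (_ * _); lia.
(* [d.-1] truncates only at d = 0, where the factor d vanishes. *)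
have P : (M + d.-1) * d = (i + d.*2 - 1) * d.
  by case: (posnP d) => [->|d0]; rewrite ?muln0 //; congr (_ * _); rewrite /M; lia.
have -> : d * d.+1 * (i + d.*2 - 1) = (i + d.*2 - 1) * d * d.+1.
  by rewrite mulnC mulnA.
by rewrite -[RHS]mulnA U -P mulnAC L -!mulnA [_ * 'C(M, i)]mulnC.
Qed.

Lemma log_concave_bins n i : 0 < i -> i.*2 <= n ->
  bins n i.-1 * bins n i.+1 <= bins n i ^ 2.
Proof.
case: i => // i _ le_in; have [d E] : exists d, n = i.+1.*2 + d by exists (n - i.+1.*2); lia.
have R0 : (i.+1 * (i + d.+2) * (i + d.+2.*2 + 2)) * bins n i.+1
    = (d.+2 * d.+3 * (i + d.+2.*2 - 1)) * bins n i.
  have En : n = i.*2 + d.+2 by lia.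
  by rewrite En; apply: bins_ratio; lia.
have R1 : (i.+2 * (i.+1 + d) * (i.+1 + d.*2 + 2)) * bins n i.+2
    = (d * d.+1 * (i.+1 + d.*2 - 1)) * bins n i.+1.
  by rewrite E; apply: bins_ratio; lia.
move: R0 R1; rewrite /=; move: (bins n i) (bins n i.+1) (bins n i.+2) => x y z.
set D0 := (X in X * y = _); set N0 := (X in _ = X * x).
set D1 := (X in X * z = _); set N1 := (X in _ = X * y) => R0 R1.
(* That is, N1 / D1 <= N0 / D0: the ratios y / x and z / y of consecutive terms decrease. *)
have DN : D0 * N1 <= D1 * N0.
  have -> : D0 * N1 = i.+1 * (d * (i + d.+2)) * d.+1
      * ((i + d.+2.*2 + 2) * (i.+1 + d.*2 - 1)).
    by rewrite /D0 /N1 -?plusE -?multE; ring.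
  have -> : D1 * N0 = i.+2 * (d.+2 * (i.+1 + d)) * d.+3
      * ((i.+1 + d.*2 + 2) * (i + d.+2.*2 - 1)).
    by rewrite /D1 /N0 -?plusE -?multE; ring.
  have -> : i + d.+2.*2 + 2 = (i + d.*2) + 6 by lia.
  have -> : i.+1 + d.*2 - 1 = i + d.*2 by lia.
  have -> : i.+1 + d.*2 + 2 = (i + d.*2) + 3 by lia.
  have -> : i + d.+2.*2 - 1 = (i + d.*2) + 3 by lia.
  (* The factors are grouped so that each inequality holds separately; with u = i + 2 d this one is
     (u + 6) u <= (u + 3)^2. *)
  apply: leq_mul; last by move: (i + d.*2) => u; clear; nia.
  apply: leq_mul; last by lia.
  by apply: leq_mul; [lia | clear; nia].
have p0 : 0 < D1 * N0 by rewrite /D1 /N0 !muln_gt0; lia.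
rewrite -(leq_pmul2l p0) -mulnn.
have -> : D1 * N0 * (x * z) = D0 * N1 * (y * y).
  transitivity ((N0 * x) * (D1 * z)); first by rewrite -?plusE -?multE; ring.
  by rewrite -R0 R1 -?plusE -?multE; ring.
by rewrite leq_mul2r DN orbT.
Qed.

Lemma bins_gt0 n i : i.*2 <= n -> 0 < bins n i.
Proof. by move=> le_in; rewrite /bins addn_gt0 bin_gt0; lia. Qed.

(** The factor 2 is the growth of the weight 2^i in the counts. Writing d = i + 1 + j encodes
    [3 * i < n]; at n = 1 and i = 0 there is equality. *)
Lemma incr_bins n i : 1 < n -> 3 * i < n -> bins n i < 2 * bins n i.+1.
Proof.
move=> n1 lt_in; have := @bins_gt0 n i; have [j E] : exists j, n = i.*2 + (i.+1 + j).
  by exists (n - 3 * i - 1); lia.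
have ij : 0 < i + j by lia.
rewrite {n}E in n1 lt_in *; have := @bins_ratio i (i.+1 + j).
move: (bins _ i) (bins _ i.+1) => x y.
set D := (X in X * y = _); set N := (X in _ = X * x) => R x0.
have DN : D < 2 * N.
  have -> : N = (i + 1 + j) * (i + 2 + j) * (3 * i + 2 * j + 1)
    by rewrite /N; congr (_ * _ * _); lia.
  have -> : D = (i + 1) * (2 * i + 1 + j) * (3 * i + 2 * j + 4)
    by rewrite /D; congr (_ * _ * _); lia.
  by clear -ij; nia.
have D0 : 0 < D by rewrite /D !muln_gt0; lia.
rewrite -(ltn_pmul2l D0) [D * (2 * y)]mulnCA R; last by lia.
by rewrite mulnA ltn_pmul2r // x0; lia.
Qed.

Lemma decr_bins n i : 0 < i -> i.*2 <= n -> n <= 3 * i -> 2 * bins n i.+1 < bins n i.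
Proof.
move=> i0 le_in le_ni; have := bins_gt0 le_in; have [d E] : exists d, n = i.*2 + d.
  by exists (n - i.*2); lia.
rewrite {n}E in le_in le_ni *; have := @bins_ratio i d.
move: (bins _ i) (bins _ i.+1) => x y.
set D := (X in X * y = _); set N := (X in _ = X * x) => R x0.
have D0 : 0 < D by rewrite /D !muln_gt0; lia.
have ND : 2 * N < D.
  (* [n <= 3 * i] means d <= i, whence d + 1 <= i + 1 and 2 d <= i + d. *)
  apply: (@leq_ltn_trans (i.+1 * (i + d) * (i + d.*2 - 1))).
    have -> : 2 * N = d.+1 * d.*2 * (i + d.*2 - 1).
      by rewrite /N -mul2n -?plusE -?multE; ring.
    by rewrite !leq_mul //; lia.
  by rewrite /D ltn_pmul2l ?muln_gt0; lia.
rewrite -(ltn_pmul2l D0) [D * (2 * y)]mulnCA R; last by lia.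
by rewrite mulnA ltn_pmul2r // x0; lia.
Qed.

Lemma min_genus0 m (S : Defs.family m) : 0 < genus_count S 0 -> min_genus S = 0.
Proof.
case/card_gt0P=> KT; rewrite inE => /eqP gKT.
rewrite /min_genus; case: arg_minnP => // KT' _ /(_ KT isT).
by rewrite gKT leqn0 => /eqP.
Qed.

Lemma max_genusP m (S : Defs.family m) r : 0 < genus_count S r ->
  (forall i, r < i -> genus_count S i = 0) -> max_genus S = r.
Proof.
case/card_gt0P=> KT; rewrite inE => /eqP gKT Sr.
apply/eqP; rewrite eqn_leq; apply/andP; split; last first.
  by rewrite -gKT /max_genus (leq_bigmax KT).
apply/bigmax_leqP=> KT' _; rewrite leqNgt; apply/negP=> /Sr /eqP.
by rewrite cards_eq0 => /eqP/setP/(_ KT'); rewrite !inE eqxx.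
Qed.

(** * Shape of either distribution: [c] is 2^n for [S6] at n, and 2^(n+2) for [S1] at n + 1 *)

Section Shape.
Variables (m n c : nat) (S : Defs.family m).
Hypothesis c0 : 0 < c.
Hypothesis countE : forall i, 2 * genus_count S i = c * (2 ^ i * bins n i).

Lemma count_gt0 i : (0 < genus_count S i) = (i.*2 <= n.+1).
Proof.
rewrite -(ltn_pmul2l (m := 2)) // muln0 countE !muln_gt0 c0 expn_gt0 /= /bins.
by rewrite addn_gt0 !bin_gt0; lia.
Qed.

Lemma min_genus_shape : min_genus S = 0.
Proof. by apply: min_genus0; rewrite count_gt0. Qed.

Lemma max_genus_shape : max_genus S = n.+1./2.
Proof.
apply: max_genusP => [|i]; first by rewrite count_gt0; lia.
by move=> lt_i; apply/eqP; rewrite -leqn0 leqNgt count_gt0; lia.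
Qed.

(** The geometric factor 2^i contributes equally to both sides. *)
Lemma log_concave_shape : distribution_log_concave S.
Proof.
rewrite /distribution_log_concave min_genus_shape max_genus_shape => i i0 lt_i.
have le_i : i.*2 <= n by lia.
have le_xz := log_concave_bins i0 le_i; rewrite -(leq_pmul2l (m := 2 * 2)) //.
rewrite -mulnn !(mulnACA 2 2).
rewrite !countE; case: i i0 le_xz {lt_i le_i} => //= i _.
rewrite !(expnS 2); move: (bins n i) (bins n i.+1) (bins n i.+2) (2 ^ i) => x y z p le_xz.
have -> : c * (p * x) * (c * (2 * (2 * p) * z)) = (c * p * 2) ^ 2 * (x * z).
  by rewrite -mulnn -?plusE -?multE; ring.
have -> : c * (2 * p * y) * (c * (2 * p * y)) = (c * p * 2) ^ 2 * y ^ 2.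
  by rewrite -!mulnn -?plusE -?multE; ring.
by rewrite leq_mul2l le_xz orbT.
Qed.

Lemma count_ltS i :
  (genus_count S i < genus_count S i.+1) = (bins n i < 2 * bins n i.+1).
Proof.
rewrite -(ltn_pmul2l (m := 2)) // !countE ltn_pmul2l //.
by rewrite expnSr -mulnA ltn_pmul2l ?expn_gt0.
Qed.

Lemma count_gtS i :
  (genus_count S i.+1 < genus_count S i) = (2 * bins n i.+1 < bins n i).
Proof.
rewrite -(ltn_pmul2l (m := 2)) // !countE ltn_pmul2l //.
by rewrite expnSr -mulnA ltn_pmul2l ?expn_gt0.
Qed.

(** The peak is n / 3 rounded up, the least i with n <= 3 i, where [incr_bins] gives way to
    [decr_bins]. At n = 1 the genera 0 and 1 tie. *)
Lemma peak_shape : n <> 1 -> distribution_peak S ((n + 2) %/ 3).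
Proof.
move=> n1; rewrite /distribution_peak min_genus_shape max_genus_shape.
set p := (n + 2) %/ 3.
have incr i : i < p -> genus_count S i < genus_count S i.+1.
  by move=> lt_ip; rewrite count_ltS; apply: incr_bins; lia.
have decr i : p <= i -> i < n.+1./2 -> genus_count S i.+1 < genus_count S i.
  by move=> le_pi lt_i; rewrite count_gtS; apply: decr_bins; lia.
split; first by rewrite leqnn.
- by lia.
- split=> [i _ lt_ip|p0]; first by apply/ltnW/incr; lia.
  by rewrite -[X in _ < genus_count S X](prednK p0); apply: incr; rewrite prednK.
- by move=> i; rewrite -eqn_leq => /eqP->.
split=> [lt_p|i lt_pi lt_i]; first exact: decr.
by apply/ltnW/decr => //; apply: ltnW.
Qed.

End Shape.

Lemma S6_shape n i : 2 * genus_count (@S6 n) i = 2 ^ n * (2 ^ i * bins n i).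
Proof. by rewrite count_S6 count_annular expnD mulnA. Qed.

Lemma S1_shape n i :
  2 * genus_count (@S1 n.+1) i = 2 ^ n.+2 * (2 ^ i * bins n i).
Proof. by rewrite count_S1S mulnCA count_annular -[4]/(2 ^ 2) !mulnA -!expnD addnA. Qed.

Theorem theorem3p2 :
  (forall n : nat, 1 <= n ->
     distribution_log_concave (@S1 n) /\ distribution_log_concave (@S6 n))
  /\ (forall n : nat, 1 <= n -> n <> 2 ->
        distribution_peak (@S1 n) ((n + 1) %/ 3))
  /\ (forall n : nat, 2 <= n ->
        distribution_peak (@S6 n) ((n + 2) %/ 3)).
Proof.
have pow_gt0 k : 0 < 2 ^ k by rewrite expn_gt0.
split; last split.
- case=> // n _; split; last exact: (log_concave_shape (pow_gt0 _) (@S6_shape _)).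
  exact: (log_concave_shape (pow_gt0 _) (@S1_shape _)).
(* [S1] at n + 1 has the shape of index n, so the exceptional value 1 becomes 2. *)
- case=> // n _ n2; rewrite addSnnS.
  by apply: (peak_shape (pow_gt0 _) (@S1_shape _)) => n1; apply: n2; rewrite n1.
- move=> n n2; apply: (peak_shape (pow_gt0 _) (@S6_shape _)) => n1.
  by rewrite n1 in n2.
Qed.
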